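(* Let $\mathbb A$ be an algebra on $\mathbb R^n$, let $U\subset\mathbb R^k$ be a simply-connected open set, let $\varphi:U\to\mathbb R^n$ be a $C^2$-function and let $f:U\to\mathbb R^n$ be a $\varphi\mathbb A$-differentiable function. Let $u_0\in U$ and for $u\in U$ define $$F(u)=\int_{u_0}^u f\,d\varphi .$$ Then $F$ is $\varphi\mathbb A$-differentiable with $F'_\varphi=f$; that is, $dF_u(\xi)=f(u)\,d\varphi_u(\xi)$ for all $u\in U$ and $\xi\in\mathbb R^k$.
   Context: An algebra $\mathbb A$ on $\mathbb R^n$ is the real linear space $\mathbb R^n$ with a bilinear, associative, commutative product having a unit $e$. For functions $f,\varphi:U\subset\mathbb R^k\to\mathbb R^n$ on an open set $U$, both differentiable in the usual sense, $f$ is $\varphi\mathbb A$-differentiable on $U$ if there is a function $f'_\varphi:U\to\mathbb R^n$ (a $\varphi\mathbb A$-derivative) such that $df_u(\xi)=f'_\varphi(u)\,d\varphi_u(\xi)$ ($\mathbb A$-product) for all $u\in U$, $\xi\in\mathbb R^k$. For a path $\gamma:[0,t_1]\to U$, the $\varphi\mathbb A$-line integral is $\int_\gamma f\,d\varphi=\int_0^{t_1} f(\gamma(s))\,d\varphi_{\gamma(s)}(\gamma'(s))\,ds$, with $\mathbb A$-product in the integrand. On a simply-connected $U$, with $\varphi$ of class $C^2$ and $f$ $\varphi\mathbb A$-differentiable, this integral depends only on the endpoints of $\gamma$, and $\int_{u_0}^u f\,d\varphi$ denotes its value for any differentiable path in $U$ from $u_0$ to $u$. *)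

(* Defs.v *)
From HB Require Import structures.
From mathcomp Require Import all_boot all_order all_algebra.
From mathcomp Require Import all_classical all_reals all_analysis.

Set Implicit Arguments.
Unset Strict Implicit.
Unset Printing Implicit Defensive.

Import Order.TTheory GRing.Theory Num.Theory.
Import numFieldNormedType.Exports.

Local Open Scope classical_set_scope.
Local Open Scope ring_scope.

Record algebra_on (R : realType) (n : nat) := AlgebraOn {
  amul :> {bilinear 'rV[R]_n -> 'rV[R]_n -> 'rV[R]_n};
  aunit : 'rV[R]_n;
  amulA : associative amul;
  amulC : commutative amul;
  amul1v : left_id aunit amul
}.

(* Functions on an open set U of R^k are represented by total functions on
   'rV[R]_k of which only the values on U matter: all the notions below are
   local, hence insensitive to the values outside U. *)

(* [class_C r U g]: g is of class C^r on the open set U. Asking for the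
   directional derivatives along all vectors v is, in finite dimension, the
   same as asking that u |-> 'd g u be of class C^(r-1). *)
Fixpoint class_C (R : realType) (k n r : nat) (U : set 'rV[R]_k)
    (g : 'rV[R]_k -> 'rV[R]_n) : Prop :=
  if r is r'.+1 then
    (forall u, U u -> differentiable g u) /\
    (forall v, class_C r' U ('D_v g))
  else forall u, U u -> {for u, continuous g}.

Definition continuous_path_in (R : realType) (k : nat) (U : set 'rV[R]_k)
    (x y : 'rV[R]_k) (g : R -> 'rV[R]_k) : Prop :=
  [/\ {within `[0, 1], continuous g}, g 0 = x, g 1 = y
    & forall s, s \in `[0, 1] -> U (g s)].

(* In H (s, t), t runs along the loop and s is the time of the homotopy. *)
Definition null_homotopic_in (R : realType) (k : nat) (U : set 'rV[R]_k)
    (x : 'rV[R]_k) (g : R -> 'rV[R]_k) : Prop :=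
  exists H : R * R -> 'rV[R]_k,
    [/\ {within `[0, 1] `*` `[0, 1], continuous H},
        forall s t, s \in `[0, 1] -> t \in `[0, 1] -> U (H (s, t)),
        forall t, t \in `[0, 1] -> H (0, t) = g t,
        forall t, t \in `[0, 1] -> H (1, t) = x
      & forall s, s \in `[0, 1] -> H (s, 0) = x /\ H (s, 1) = x].

Definition simply_connected (R : realType) (k : nat) (U : set 'rV[R]_k) :=
  (forall x y, U x -> U y -> exists g, continuous_path_in U x y g) /\
  (forall x g, continuous_path_in U x x g -> null_homotopic_in U x g).

Definition phiA_derivative (R : realType) (k n : nat) (A : algebra_on R n)
    (U : set 'rV[R]_k) (phi f f' : 'rV[R]_k -> 'rV[R]_n) : Prop :=
  forall u, U u ->
    [/\ differentiable phi u, differentiable f u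
      & forall xi, 'd f u xi = A (f' u) ('d phi u xi)].

Definition phiA_differentiable (R : realType) (k n : nat) (A : algebra_on R n)
    (U : set 'rV[R]_k) (phi f : 'rV[R]_k -> 'rV[R]_n) : Prop :=
  exists f', phiA_derivative A U phi f f'.

(* A path on [0, t1] is given by a function on R, whose derivative at the
   endpoints is two-sided: every map that is C^1 on [0, t1] with one-sided
   derivatives at 0 and t1 extends to such a function. Continuity of the
   derivative makes the integrand of the line integral integrable. *)
Definition C1_path_in (R : realType) (k : nat) (U : set 'rV[R]_k)
    (x y : 'rV[R]_k) (t1 : R) (gamma : R -> 'rV[R]_k) : Prop :=
  [/\ 0 < t1,
      forall s, s \in `[0, t1] -> U (gamma s) /\ derivable gamma s 1,
      {within `[0, t1], continuous (derive1 gamma)},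
      gamma 0 = x
    & gamma t1 = y].

Definition line_integral (R : realType) (k n : nat) (A : algebra_on R n)
    (f phi : 'rV[R]_k -> 'rV[R]_n) (t1 : R) (gamma : R -> 'rV[R]_k) :
    'rV[R]_n :=
  \row_(j < n) \int[lebesgue_measure]_(s in `[0, t1])
    (A (f (gamma s)) ('d phi (gamma s) (derive1 gamma s))) 0 j.

(* The common value of the line integrals along all the paths in U from u0 to
   u, selected by [get]; it is unspecified if these integrals disagree. *)
Definition endpoint_integral (R : realType) (k n : nat) (A : algebra_on R n)
    (U : set 'rV[R]_k) (f phi : 'rV[R]_k -> 'rV[R]_n) (u0 u : 'rV[R]_k) :
    'rV[R]_n :=
  get [set I | forall t1 gamma, C1_path_in U u0 u t1 gamma ->
                 line_integral A f phi t1 gamma = I].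

(* Main.v *)
From HB Require Import structures.
Require Import Defs.
From mathcomp Require Import all_boot all_order all_algebra.
From mathcomp Require Import all_classical all_reals all_analysis.
From mathcomp Require Import ring lra.
Import Order.TTheory GRing.Theory Num.Theory.
Import numFieldNormedType.Exports.
Local Open Scope classical_set_scope.
Local Open Scope ring_scope.
Set Implicit Arguments.
Unset Strict Implicit.
Unset Printing Implicit Defensive.

(* Each coordinate w of the form f dphi is a continuous real 1-form which, near
   any u, differs by o(|v - u|) from the exact form with primitive
     E v = f(u) phi(v) + f'(u) (dphi_u (v - u))^2 / 2
   (commutativity and associativity of A make dE come out right).  As f' is
   arbitrary, w need not be C^1; instead, Goursat's bisection argument only
   uses this approximation and shows that w integrates to 0 along triangles, so
   that w has a primitive on every small ball.  Primitives on balls are glued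
   along chains of points: a closed chain bounds a polygonal loop, and cutting
   the square of a null homotopy of that loop into cells each sent into one
   ball shows that the total increment vanishes.  This gives a primitive G of w
   on U; by the fundamental theorem of calculus the line integrals are
   differences of values of G, hence F = G - G(u0) coordinatewise. *)

(** * Antiderivatives on the unit interval *)

Section line.
Context {R : realType} {V : normedModType R}.

Lemma is_diff_line (a d : V) (t : R) :
  is_diff t (fun s : R => a + s *: d) ( *:%R^~ d).
Proof. by apply: (is_diff_eq (f' := 0 + *:%R^~ d)); rewrite add0r. Qed.

Lemma is_derive_line (G L : V -> R) (a d : V) (t : R) :
  is_diff (a + t *: d) G L ->
  is_derive t (1 : R) (fun s : R => G (a + s *: d)) (L d).
Proof.
move=> GL.
have dline := is_diff_line a d t.
have dG : is_diff t (G \o (fun s : R => a + s *: d)) (L \o *:%R^~ d).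
  exact: is_diff_comp.
apply: DeriveDef; first by apply: diff_derivable; exact: ex_diff.
by rewrite deriveE ?diff_val /= ?scale1r//; exact: ex_diff.
Qed.

End line.

Section antiderivatives.
Context {R : realType}.

Lemma is_derive_rescale (P : R -> R) (x a b : R) (t : R) :
  is_derive (a + t * b) (1 : R) P x ->
  is_derive t (1 : R) (fun s : R => P (a + s * b)) (b * x).
Proof.
move=> Px; apply: (is_derive_line (V := R) (L := fun h => h * x) (a := a) (d := b)).
apply: DiffDef; first by apply/derivable1_diffP.
rewrite deriv1E//; apply/funext => h; rewrite derive1E derive_val.
by [].
Qed.

Lemma is_derive_subr (P : R -> R) (x c t : R) :
  is_derive (t - c) (1 : R) P x -> is_derive t (1 : R) (fun s : R => P (s - c)) x.
Proof.
have := @is_derive_rescale P x (- c) 1 t.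
rewrite mulr1 addrC mul1r => dP /dP.
by under eq_fun do rewrite mulr1 addrC.
Qed.

Lemma is_derive_scalel {V : normedModType R} (P : R -> R) (x t : R) (v : V) :
  is_derive t (1 : R) P x -> is_derive t (1 : R) (fun s : R => P s *: v) (x *: v).
Proof.
move=> dP.
have dP' : is_diff t P (fun h => h * x).
  apply: DiffDef; first by apply/derivable1_diffP.
  by rewrite deriv1E//; apply/funext => h; rewrite derive1E derive_val.
have [d dE] := is_diff_comp dP' (is_diff_scalel (P t) v).
apply: DeriveDef; first exact: diff_derivable d.
by rewrite (deriveE _ d) dE /= mul1r.
Qed.

(** Mean value theorem for [P - Q]. With [C = 0], equal derivatives give equal increments, which
    replaces changes of variables in the integrals below. *)
Lemma increment_close (P Q p q : R -> R) (C : R) :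
  {in `[0, 1], forall t : R, is_derive t (1 : R) P (p t)} ->
  {in `[0, 1], forall t : R, is_derive t (1 : R) Q (q t)} ->
  {in `[0, 1], forall t, `|p t - q t| <= C} ->
  `|(P 1 - P 0) - (Q 1 - Q 0)| <= C.
Proof.
move=> dP dQ pqC.
have dPQ : {in `[0, 1], forall t : R, is_derive t (1 : R) (P \- Q) (p t - q t)}.
  move=> t t01; have ? := dP t t01; have ? := dQ t t01; exact: is_deriveB.
have [|||c c01] := @MVT_segment R (P \- Q) (fun t => p t - q t) 0 1.
- exact: ler01.
- by move=> x x01; apply: dPQ; exact: subset_itv_oo_cc.
- apply: derivable_within_continuous => x x01.
  by have ? := dPQ _ x01; exact: ex_derive.
rewrite subr0 mulr1 /= => E.
suff -> : P 1 - P 0 - (Q 1 - Q 0) = p c - q c by exact: pqC.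
by rewrite -E; ring.
Qed.

(** Retraction of the line onto the unit interval: composing with it yields a function continuous
    everywhere from one continuous at the points of [0, 1]. *)
Definition clamp01 (t : R) : R := Num.max 0 (Num.min 1 t).

Lemma clamp01_itv t : clamp01 t \in `[0, 1].
Proof. by rewrite in_itv /= /clamp01 le_max lexx /= ge_max ler01 ge_min lexx. Qed.

Lemma clamp01_id t : t \in `[0, 1] -> clamp01 t = t.
Proof.
by rewrite in_itv /= /clamp01 => /andP[t0 t1]; rewrite (min_idPr t1) (max_idPr t0).
Qed.

Lemma continuous_clamp01 : continuous clamp01.
Proof.
move=> t.
have cmin : {for t, continuous ((cst 1 : R -> R^o) \min id)}.
  by apply: continuous_min; [exact: cst_continuous|move=> ?].
have := @continuous_max R R (cst 0) ((cst 1 : R -> R^o) \min id) t.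
by apply; [exact: cst_continuous|].
Qed.

(* Clamping the argument and starting at -1 makes the derivatives at 0 and 1
   two-sided. *)
Definition antiderivative (g : R -> R) (x : R) : R :=
  \int[lebesgue_measure]_(t in `[-1, x]) g (clamp01 t).

Lemma is_derive_antiderivative (g : R -> R) :
  {in `[0, 1], forall t : R, {for t, continuous g}} ->
  {in `[0, 1], forall t : R, is_derive t (1 : R) (antiderivative g) (g t)}.
Proof.
move=> cg t t01.
have cgc : continuous (g \o clamp01).
  move=> x; apply: continuous_comp; first exact: continuous_clamp01.
  by apply: cg; exact: clamp01_itv.
have t0 : 0 <= t by move: t01; rewrite in_itv /= => /andP[].
(* The base point [-1] and the upper bound [t + 1] put [t] strictly inside the interval of
   integration, also when [t] is 0 or 1. *)
have [] := @continuous_FTC1_closed R (g \o clamp01) (-1) t (t + 1).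
- by rewrite ltrDl.
- apply: continuous_compact_integrable; first exact: segment_compact.
  exact: continuous_subspaceT.
- by rewrite (lt_le_trans _ t0)// ltrN10.
- exact: cgc.
by rewrite derive1E /= clamp01_id.
Qed.

End antiderivatives.

(** * Integrals of 1-forms along segments *)

Definition seg_integrand {R : realType} {V : normedModType R} (w : V -> V -> R)
  (a d : V) (t : R) : R := w (a + t *: d) d.

HB.lock Definition seg_int {R : realType} {V : normedModType R}
    (w : V -> V -> R) (a b : V) : R :=
  antiderivative (seg_integrand w a (b - a)) 1 -
  antiderivative (seg_integrand w a (b - a)) 0.

Section forms.
Context {R : realType} {V : normedModType R}.
Implicit Types (w : V -> V -> R) (U B : set V) (a b c d : V).

Definition segment_closed B :=
  forall a b (t : R), B a -> B b -> t \in `[0, 1] -> B (a + t *: (b - a)).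

Lemma norm_segment_le c a b (t r : R) : t \in `[0, 1] ->
  `|c - a| <= r -> `|c - b| <= r -> `|c - (a + t *: (b - a))| <= r.
Proof.
rewrite in_itv /= => /andP[t0 t1] ca cb.
have -> : c - (a + t *: (b - a)) = (1 - t) *: (c - a) + t *: (c - b).
  rewrite scalerBl scale1r -addrA [- _ + _]addrC -scalerBr opprB addrC.
  by rewrite [c - b + _]addrC subrKA opprD -scalerN opprB addrA addrC.
rewrite (le_trans (ler_normD _ _))// !normrZ.
rewrite (ger0_norm t0) ger0_norm ?subr_ge0//.
by nra.
Qed.

Lemma segment_closed_ball c (r : R) : segment_closed (ball c r).
Proof.
move=> a b t; rewrite -!ball_normE /= => ca cb t01.
apply: (@le_lt_trans _ _ (Num.max `|c - a| `|c - b|)).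
  by apply: norm_segment_le; rewrite // le_max lexx ?orbT.
by rewrite gt_max ca cb.
Qed.

(** Continuity for the operator norm. Linearity of [w u] is left to [infinitesimally_exact], which
    makes it a differential. *)
Definition continuous_form U w := forall u, U u -> forall e : R, 0 < e ->
  \forall v \near u, forall xi, `|w v xi - w u xi| <= e * `|xi|.

(** Pointwise substitute for closedness: the exact form ['d E] may change with [u], and no
    derivative of [w] is involved. *)
Definition infinitesimally_exact U w := forall u, U u ->
  exists E : V -> R, [/\ forall v, U v -> differentiable E v,
    w u = 'd E u :> (V -> R) &
    forall e : R, 0 < e -> \forall v \near u, forall xi,
      `|w v xi - 'd E v xi| <= e * `|v - u| * `|xi| ].

Definition primitive_on B w (G : V -> R) := forall v, B v -> is_diff v G (w v).

Lemma continuous_seg_integrand U w a d (t : R) :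
  continuous_form U w -> U (a + t *: d) ->
  {for t, continuous (seg_integrand w a d)}.
Proof.
move=> cw Ut; apply/cvgrPdist_le => /= e e0.
have d0 : 0 < `|d| + 1 by rewrite ltr_wpDl.
have ct : {for t, continuous (fun s : R => a + s *: d)}.
  by apply: differentiable_continuous; have ? := is_diff_line a d t; exact: ex_diff.
have : \forall s \near t, forall xi,
    `|w (a + s *: d) xi - w (a + t *: d) xi| <= e / (`|d| + 1) * `|xi|.
  exact: ct _ (cw _ Ut (e / (`|d| + 1)) (divr_gt0 e0 d0)).
apply: filterS => s /(_ d) h.
rewrite distrC (le_trans h)// mulrAC ler_pdivrMr// ler_pM2l// lerDl.
exact: ler01.
Qed.

Lemma is_derive_seg_int U w a b : continuous_form U w ->
  {in `[0, 1], forall t : R, U (a + t *: (b - a))} ->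
  {in `[0, 1], forall t : R, is_derive t (1 : R)
    (antiderivative (seg_integrand w a (b - a))) (w (a + t *: (b - a)) (b - a))}.
Proof.
move=> cw Uab; apply: is_derive_antiderivative => t t01.
exact/(continuous_seg_integrand cw)/Uab.
Qed.

(** Mean value comparison of [w] with the form ['d E] along the segment; [C = 0] serves when [E] is
    a primitive of [w]. *)
Lemma seg_int_close U w (E : V -> R) a b (C : R) : continuous_form U w ->
  {in `[0, 1], forall t : R, U (a + t *: (b - a))} ->
  {in `[0, 1], forall t : R, differentiable E (a + t *: (b - a))} ->
  {in `[0, 1], forall t : R,
    `|w (a + t *: (b - a)) (b - a) - 'd E (a + t *: (b - a)) (b - a)| <= C} ->
  `|seg_int w a b - (E b - E a)| <= C.
Proof.
move=> cw Uab dE wE.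
have dEl : {in `[0, 1], forall t : R, is_derive t (1 : R)
   (fun s : R => E (a + s *: (b - a))) ('d E (a + t *: (b - a)) (b - a))}.
  by move=> t t01; apply: is_derive_line; apply/differentiableP/dE.
have := increment_close (is_derive_seg_int cw Uab) dEl wE.
by rewrite seg_int.unlock scale1r scale0r addr0 subrKC.
Qed.

(** Both sides are increments of functions of one parameter with the same derivative. As [s] and [t]
    come in any order, this covers reversal and bisection of segments. *)
Lemma seg_int_sub U w a b (s t : R) : continuous_form U w ->
  (forall u, U u -> scalable_for *%R (w u)) ->
  {in `[0, 1], forall t : R, U (a + t *: (b - a))} ->
  s \in `[0, 1] -> t \in `[0, 1] ->
  seg_int w (a + s *: (b - a)) (a + t *: (b - a)) =
  antiderivative (seg_integrand w a (b - a)) t -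
  antiderivative (seg_integrand w a (b - a)) s.
Proof.
move=> cw lw Uab s01 t01.
set d := b - a; set P := antiderivative (seg_integrand w a d).
have sub x : x \in `[0, 1] -> s + x * (t - s) \in `[0, 1].
  move: s01 t01; rewrite !in_itv /= => /andP[? ?] /andP[? ?] /andP[? ?].
  by apply/andP; split; nra.
have e x : a + s *: d + x *: (a + t *: d - (a + s *: d)) =
    a + (s + x * (t - s)) *: d.
  by rewrite opprD addrACA subrr add0r -scalerBl scalerA -addrA -scalerDl.
have Ust : {in `[0, 1], forall x : R,
    U (a + s *: d + x *: (a + t *: d - (a + s *: d)))}.
  by move=> x x01; rewrite e; apply/Uab/sub.
have dP : {in `[0, 1], forall x : R, is_derive x (1 : R)
    (fun x : R => P (s + x * (t - s)))
    ((t - s) * w (a + (s + x * (t - s)) *: d) d)}.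
  move=> x x01; apply: is_derive_rescale.
  exact/(is_derive_seg_int cw Uab)/sub.
have := increment_close (is_derive_seg_int cw Ust) dP.
move=> /(_ 0) h; rewrite seg_int.unlock; apply/eqP; rewrite -subr_eq0 -normr_le0.
have := h; rewrite mul1r mul0r addr0 subrKC; apply=> x x01.
rewrite e opprD addrACA subrr add0r -scalerBl lw ?subrr ?normr0//.
exact/Uab/sub.
Qed.

Lemma seg_int_rev U w a b : continuous_form U w ->
  (forall u, U u -> scalable_for *%R (w u)) ->
  {in `[0, 1], forall t : R, U (a + t *: (b - a))} ->
  seg_int w b a = - seg_int w a b.
Proof.
move=> cw lw Uab.
have := @seg_int_sub U w a b 1 0 cw lw Uab.
rewrite scale1r scale0r subrKC addr0 => ->; rewrite ?in_itv /= ?ler01 ?lexx//.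
by rewrite seg_int.unlock opprB.
Qed.

Lemma midpointE a m b : m - a = b - m -> a + 2^-1 *: (b - a) = m.
Proof.
move=> mid; have -> : b - a = 2 *: (m - a).
  by rewrite scaler_nat mulr2n {1}mid subrKA.
by rewrite scalerA mulVf ?pnatr_eq0// scale1r subrKC.
Qed.

Lemma seg_int_midpoint U w a m b : continuous_form U w ->
  (forall u, U u -> scalable_for *%R (w u)) ->
  {in `[0, 1], forall t : R, U (a + t *: (b - a))} ->
  m - a = b - m -> seg_int w a b = seg_int w a m + seg_int w m b.
Proof.
move=> cw lw Uab mid.
have h2 : (2^-1 : R) \in `[0, 1] by rewrite in_itv /=; lra.
have em := midpointE mid.
have := @seg_int_sub U w a b 0 2^-1 cw lw Uab.
have := @seg_int_sub U w a b 2^-1 1 cw lw Uab.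
rewrite em scale1r scale0r subrKC addr0 => -> ; rewrite ?in_itv /= ?ler01 ?lexx//.
move=> ->; rewrite ?in_itv /= ?ler01 ?lexx//.
by rewrite seg_int.unlock [RHS]addrC subrKA.
Qed.

Lemma exact_scalable U w : infinitesimally_exact U w ->
  forall u, U u -> scalable_for *%R (w u).
Proof. by move=> ew u /ew[E [_ -> _]] c x; rewrite linearZ. Qed.

End forms.

(** * Goursat's lemma *)

(** Pigeonhole for the bisection: if all four parts were below a quarter of the total, the triangle
    inequality would fail. *)
Lemma norm_add4_le {R : realType} (T1 T2 T3 T4 : R) :
  let T := T1 + T2 + T3 + T4 in
  [\/ `|T| <= 4 * `|T1|, `|T| <= 4 * `|T2|, `|T| <= 4 * `|T3|
    | `|T| <= 4 * `|T4| ].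
Proof.
move=> T; have [h1|h1] := leP `|T| (4 * `|T1|); first exact: Or41.
have [h2|h2] := leP `|T| (4 * `|T2|); first exact: Or42.
have [h3|h3] := leP `|T| (4 * `|T3|); first exact: Or43.
apply: Or44; have := ler_normD (T1 + T2 + T3) T4.
by have := ler_normD (T1 + T2) T3; have := ler_normD T1 T2; rewrite -/T; lra.
Qed.

Section goursat.
Context {R : realType} {k : nat}.
Local Notation V := 'rV[R]_k.
Variables (U B : set V) (w : V -> V -> R).
Hypotheses (cw : continuous_form U w) (ew : infinitesimally_exact U w).
Hypotheses (cB : segment_closed B) (BU : closure B `<=` U).

Let BU' : B `<=` U. Proof. exact: subset_trans (@subset_closure _ B) BU. Qed.

Let sw := exact_scalable ew.

Let Bseg a b : B a -> B b -> {in `[0, 1], forall t : R, U (a + t *: (b - a))}.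
Proof. by move=> Ba Bb t t01; apply/BU'/cB. Qed.

Let Bmid a m b : B a -> B b -> m - a = b - m -> B m.
Proof.
move=> Ba Bb mid.
rewrite -(midpointE mid); apply: cB => //; rewrite in_itv /=; apply/andP; split; lra.
Qed.

Definition tri_int (a b c : V) := seg_int w a b + seg_int w b c + seg_int w c a.

(** The midpoints [a'], [b'], [c'] halve the three sides; each side of the middle triangle is run
    twice, in opposite directions, and cancels. *)
Lemma tri_int_subdiv a b c a' b' c' : B a -> B b -> B c ->
  c' - a = b - c' -> a' - b = c - a' -> b' - c = a - b' ->
  tri_int a b c = tri_int a c' b' + tri_int c' b a' + tri_int b' a' c +
    tri_int a' b' c'.
Proof.
move=> Ba Bb Bc Ec Ea Eb.
have Ba' := Bmid Bb Bc Ea; have Bb' := Bmid Bc Ba Eb; have Bc' := Bmid Ba Bb Ec.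
rewrite /tri_int (seg_int_midpoint cw sw (Bseg Ba Bb) Ec).
rewrite (seg_int_midpoint cw sw (Bseg Bb Bc) Ea).
rewrite (seg_int_midpoint cw sw (Bseg Bc Ba) Eb).
rewrite (seg_int_rev cw sw (Bseg Ba' Bb')) (seg_int_rev cw sw (Bseg Bb' Bc')).
rewrite (seg_int_rev cw sw (Bseg Ba' Bc')).
move: (seg_int w a c') (seg_int w c' b) (seg_int w b a') (seg_int w a' c).
move: (seg_int w c b') (seg_int w b' a) (seg_int w a' b') (seg_int w b' c').
by move: (seg_int w a' c') => *; ring.
Qed.

(* A triangle similar to (a, a + x, a + y) is coded by its vertex p and its
   ratio l, negative for the middle triangle of a subdivision. *)
Let tri x y (s : V * R) := tri_int s.1 (s.1 + s.2 *: x) (s.1 + s.2 *: y).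

Let triB x y (s : V * R) :=
  [/\ B s.1, B (s.1 + s.2 *: x) & B (s.1 + s.2 *: y)].

(** One of the four midpoint triangles carries at least a quarter of the integral in absolute value.
    The vertex moves by [0], [h *: x], [h *: y] or [h *: (x + y)], hence by at most the stated
    bound. *)
Lemma tri_int_step (x y : V) (s : V * R) : triB x y s ->
  exists s', [/\ triB x y s', `|s'.2| = `|s.2| / 2,
    `|s'.1 - s.1| <= `|s.2| * (`|x| + `|y|) &
    `|tri x y s| <= 4 * `|tri x y s'| ].
Proof.
case: s => p l [/= Ba Bb Bc]; rewrite /tri /=.
pose h := l / 2.
have lz (z : V) : l *: z = h *: z + h *: z by rewrite -scalerDl -splitr.
have pK v v' : p + v - (p + v') = v - v' by rewrite opprD addrACA subrr add0r.
have Ec : p + h *: x - p = p + l *: x - (p + h *: x).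
  by rewrite lz addrA addrAC subrr add0r addrAC subrr add0r.
have Ea : p + h *: (x + y) - (p + l *: x) = p + l *: y - (p + h *: (x + y)).
  rewrite !lz scalerDr !pK [in LHS]opprD [LHS]addrACA subrr add0r.
  by rewrite [in RHS]opprD [RHS]addrACA subrr addr0.
have Eb : p + h *: y - (p + l *: y) = p - (p + h *: y).
  rewrite !lz pK opprD addrA subrr sub0r.
  by rewrite opprD addrA subrr sub0r.
have Ba' := Bmid Bb Bc Ea; have Bb' := Bmid Bc Ba Eb; have Bc' := Bmid Ba Bb Ec.
have sub := tri_int_subdiv Ba Bb Bc Ec Ea Eb.
have Px : p + h *: x + h *: x = p + l *: x by rewrite lz addrA.
have Py : p + h *: y + h *: y = p + l *: y by rewrite lz addrA.
have Pxy : p + h *: x + h *: y = p + h *: (x + y) by rewrite scalerDr addrA.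
have Pyx : p + h *: y + h *: x = p + h *: (x + y) by rewrite -Pxy addrAC.
have Pmx : p + h *: (x + y) + (- h) *: x = p + h *: y.
  by rewrite -Pyx scaleNr addrK.
have Pmy : p + h *: (x + y) + (- h) *: y = p + h *: x.
  by rewrite -Pxy scaleNr addrK.
have nh : `|h| = `|l| / 2 by rewrite /h normrM [`|2^-1|]ger0_norm.
have hz (z : V) : `|z| <= `|x| + `|y| -> `|h *: z| <= `|l| * (`|x| + `|y|).
  by move=> zxy; rewrite normrZ ler_pM// nh ler_pdivrMr// ler_peMr// ler1n.
have t1 := normr_ge0 x; have t2 := normr_ge0 y.
pose T1 := tri_int p (p + h *: x) (p + h *: y).
pose T2 := tri_int (p + h *: x) (p + l *: x) (p + h *: (x + y)).
pose T3 := tri_int (p + h *: y) (p + h *: (x + y)) (p + l *: y).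
pose T4 := tri_int (p + h *: (x + y)) (p + h *: y) (p + h *: x).
have {}sub : tri_int p (p + l *: x) (p + l *: y) = T1 + T2 + T3 + T4.
  by [].
rewrite sub; have [h1|h2|h3|h4] := norm_add4_le T1 T2 T3 T4.
- exists (p, h); split=> /=; [exact: And3|exact: nh| |exact: h1].
  by rewrite subrr normr0 mulr_ge0 ?addr_ge0.
- exists (p + h *: x, h); split=> /=; [|exact: nh| |].
  + by rewrite /triB /= Px Pxy; exact: And3.
  + by rewrite addrC addKr; apply: hz; rewrite lerDl.
  + by rewrite Px Pxy; exact: h2.
- exists (p + h *: y, h); split=> /=; [|exact: nh| |].
  + by rewrite /triB /= Py Pyx; exact: And3.
  + by rewrite addrC addKr; apply: hz; rewrite lerDr.
  + by rewrite Py Pyx; exact: h3.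
- exists (p + h *: (x + y), - h); split=> /=; [|by rewrite normrN| |].
  + by rewrite /triB /= Pmx Pmy; exact: And3.
  + by rewrite addrC addKr; apply: hz; exact: ler_normD.
  + by rewrite Pmx Pmy; exact: h4.
Qed.

Lemma geometric_limit (p : nat -> V) (D : R) :
  (forall n, `|p n.+1 - p n| <= D * 2^-1 ^+ n) ->
  exists l, forall n, `|l - p n| <= 2 * D * 2^-1 ^+ n.
Proof.
move=> pD.
(* Subtracting [2^-1 ^+ (n + m)] gives the exact geometric sum, a bound that induction on [m] can
   carry. *)
have pnm n m : `|p (n + m)%N - p n| <= 2 * D * (2^-1 ^+ n - 2^-1 ^+ (n + m)).
  elim: m => [|m IH]; first by rewrite addn0 !subrr normr0 mulr0.
  rewrite addnS -(subrKA (p (n + m)%N)) (le_trans (ler_normD _ _))//.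
  have := pD (n + m)%N; rewrite exprS; lra.
have D0 : 0 <= D by have := le_trans (normr_ge0 _) (pD 0%N); rewrite expr0 mulr1.
have half_gt0 n : 0 < (2^-1 : R) ^+ n by rewrite exprn_gt0.
have pnm' n m : `|p (n + m)%N - p n| <= 2 * D * 2^-1 ^+ n.
  by rewrite (le_trans (pnm n m))// ler_wpM2l ?mulr_ge0// gerBl ltW.
have half_cvg : (fun n => 2 * D * 2^-1 ^+ n) @ \oo --> (0 : R).
  by apply: (@cvg_geometric R (2 * D) 2^-1); rewrite ger0_norm//; lra.
have cp : cvgn p.
  apply: cauchy_cvg; apply: cauchy_exP => e e0.
  have [N _ hN] := (cvgrPdist_lt _ _).1 half_cvg e e0.
  exists (p N); exists N => // m /= Nm.
  rewrite -(subnKC Nm) -ball_normE /= distrC (le_lt_trans (pnm' _ _))//.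
  have := hN N (leqnn N); rewrite sub0r normrN; exact/le_lt_trans/ler_norm.
exists (limn p) => n.
apply/ler_addgt0Pr => e e0.
have [N _ hN] := (cvgrPdist_lt _ _).1 cp e e0.
have := hN (n + N)%N (leq_addl _ _) => /= hlim.
rewrite -(subrKA (p (n + N)%N)) (le_trans (ler_normD _ _))//.
by rewrite addrC lerD// ltW.
Qed.

(** The increments of [E] cancel around the triangle. Each edge has length at most [2 * r], and
    along it the forms differ by at most [e * r] per unit of length; three edges give
    [6 * e * r ^+ 2]. *)
Lemma tri_int_small (a b c : V) (E : V -> R) (l : V) (e r : R) : 0 <= e ->
  (forall v, U v -> differentiable E v) ->
  (forall v, `|l - v| <= r -> forall xi,
     `|w v xi - 'd E v xi| <= e * `|v - l| * `|xi|) ->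
  B a -> B b -> B c -> `|l - a| <= r -> `|l - b| <= r -> `|l - c| <= r ->
  `|tri_int a b c| <= 6 * e * r ^+ 2.
Proof.
move=> e0 dE wE Ba Bb Bc la lb lc.
have edge x y : B x -> B y -> `|l - x| <= r -> `|l - y| <= r ->
    `|seg_int w x y - (E y - E x)| <= 2 * e * r ^+ 2.
  move=> Bx By lx ly.
  apply: (seg_int_close cw (Bseg Bx By)).
    by move=> t t01; apply/dE/(Bseg Bx By).
  move=> t t01; have lt := norm_segment_le t01 lx ly.
  rewrite (le_trans (wE _ lt _))// [`|_ - l|]distrC.
  have yx : `|y - x| <= r + r.
    by rewrite -(subrKA l) (le_trans (ler_normD _ _))// lerD// distrC.
  have := normr_ge0 (l - (x + t *: (y - x))); have := normr_ge0 (y - x).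
  set m := `|l - _|; set q := `|y - x| => q0 m0.
  have r0 : 0 <= r by exact: le_trans lt.
  apply: (@le_trans _ _ (e * r * (r + r))); last by rewrite expr2; lra.
  by rewrite -!mulrA ler_wpM2l// ler_pM.
have h1 := edge _ _ Ba Bb la lb; have h2 := edge _ _ Bb Bc lb lc.
have h3 := edge _ _ Bc Ba lc la.
have -> : tri_int a b c = (seg_int w a b - (E b - E a)) +
    (seg_int w b c - (E c - E b)) + (seg_int w c a - (E a - E c)).
  rewrite /tri_int; move: (seg_int w a b) (seg_int w b c) (seg_int w c a) => *.
  by ring.
rewrite (le_trans (ler_normD _ _))//.
by have := ler_normD (seg_int w a b - (E b - E a)) (seg_int w b c - (E c - E b)); lra.
Qed.

(** Along nested triangles the integral shrinks by a factor of at most 4 at each step, while near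
    their limit point it is bounded by an arbitrarily small multiple of [4^-n]; so it was 0. *)
Theorem goursat a b c : B a -> B b -> B c -> tri_int a b c = 0.
Proof.
move=> Ba Bb Bc; pose x := b - a; pose y := c - a; pose D := `|x| + `|y|.
have [f fP] : exists f : V * R -> V * R, forall s, triB x y s ->
    [/\ triB x y (f s), `|(f s).2| = `|s.2| / 2,
    `|(f s).1 - s.1| <= `|s.2| * D & `|tri x y s| <= 4 * `|tri x y (f s)| ].
  have /choice[f fP] : forall s, exists s', triB x y s ->
      [/\ triB x y s', `|s'.2| = `|s.2| / 2,
      `|s'.1 - s.1| <= `|s.2| * D & `|tri x y s| <= 4 * `|tri x y s'| ].
    move=> s; have [/tri_int_step[s' ?]|ns] := pselect (triB x y s).
      by exists s'.
    by exists s.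
  by exists f.
pose s n := iter n f (a, 1).
have sB n : triB x y (s n).
  elim: n => [|n /fP[]//]; split => //=; by rewrite scale1r subrKC.
have s2 n : `|(s n).2| = 2^-1 ^+ n.
  elim: n => [|n IH]; first by rewrite normr1 expr0.
  by have [_ -> _ _] := fP _ (sB n); rewrite IH exprSr.
have aux (q C1 C2 C3 : R) : C1 * q ^+ 2 <= C2 -> C2 <= 4 * C3 ->
  C1 * (2^-1 * q) ^+ 2 <= C3 by rewrite exprMn; lra.
have sT n : `|tri_int a b c| * (2^-1 ^+ n) ^+ 2 <= `|tri x y (s n)|.
  elim: n => [|n IH].
    by rewrite expr0 expr1n mulr1 /tri /= !scale1r !subrKC.
  have [_ _ _ h] := fP _ (sB n).
  by rewrite (exprS _ n); exact: aux IH h.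
have [l lP] : exists l, forall n, `|l - (s n).1| <= 2 * D * 2^-1 ^+ n.
  apply: (@geometric_limit (fun n => (s n).1) D) => n.
  by have [_ _ h _] := fP _ (sB n); rewrite (le_trans h)// s2 mulrC.
have D0 : 0 <= D by rewrite addr_ge0.
have half_cvg (C : R) : (fun n => C * 2^-1 ^+ n) @ \oo --> (0 : R).
  by apply: (@cvg_geometric R C 2^-1); rewrite ger0_norm//; lra.
have small (C e : R) : 0 < e -> exists n, C * 2^-1 ^+ n < e.
  move=> e0; have [N _ hN] := (cvgrPdist_lt _ _).1 (half_cvg C) e e0.
  exists N; have := hN N (leqnn N); rewrite sub0r normrN.
  exact/le_lt_trans/ler_norm.
have half_gt0 n : 0 < (2^-1 : R) ^+ n by rewrite exprn_gt0.
(* The limit is only known to lie in the closure of [B], which is why the closure is assumed to be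
   inside [U]. *)
have lU : U l.
  apply: BU => A /nbhs_ballP[e /= e0 eA].
  have [n hn] := small (2 * D) e e0.
  exists (s n).1; split; first by have [] := sB n.
  by apply: eA; rewrite -ball_normE /= (le_lt_trans (lP n)).
have [E [dE wl wE]] := ew lU.
apply/eqP; rewrite -normr_le0; apply/ler_addgt0Pr => e e0; rewrite add0r.
(* [54 = 6 * 3 ^ 2]: [tri_int_small] is applied with radius [3 * D * 2^-1 ^+ n]. The added 1 keeps
   the denominator positive when [D = 0]. *)
pose e' := e / (54 * D ^+ 2 + 1).
have D54 : 0 < 54 * D ^+ 2 + 1 by rewrite ltr_wpDl// mulr_ge0// exprn_ge0.
have e'0 : 0 < e' by exact: divr_gt0.
have /nbhs_ballP[d /= d0 dwE] := wE e' e'0.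
have [n hn] := small (3 * D) d d0.
have close z : `|z| <= D -> `|l - ((s n).1 + (s n).2 *: z)| <= 3 * D * 2^-1 ^+ n.
  move=> zD; rewrite opprD addrA (le_trans (ler_normB _ _))//.
  rewrite normrZ s2; have := lP n; have := half_gt0 n.
  by have := normr_ge0 z; nra.
have [Bp Bx By] := sB n.
have := @tri_int_small _ _ _ E l e' (3 * D * 2^-1 ^+ n) (ltW e'0) dE _ Bp Bx By.
have -> : 6 * e' * (3 * D * 2^-1 ^+ n) ^+ 2 = e' * (54 * D ^+ 2) * (2^-1 ^+ n) ^+ 2.
  by ring.
move=> h; have {}h := le_trans (sT n) (h _ _ _ _).
apply: (@le_trans _ _ (e' * (54 * D ^+ 2))).
  rewrite -(ler_pM2r (exprn_gt0 2 (half_gt0 n))) h//.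
  - move=> v lv xi; apply: dwE; rewrite -ball_normE /=; exact: le_lt_trans hn.
  - by have := close 0; rewrite scaler0 addr0; apply; rewrite normr0.
  - by apply: close; rewrite lerDl.
  - by apply: close; rewrite lerDr.
rewrite /e' -mulrA; apply: ler_piMr; first exact: ltW.
by rewrite mulrC ler_pdivrMr// mul1r lerDl.
Qed.

End goursat.

(** * Local primitives *)

Lemma is_diff_near0 {R : realType} {V W : normedModType R} (G : V -> W)
    (L : {linear V -> W}) (v : V) : continuous L ->
  (forall e : R, 0 < e -> \forall h \near 0, `|G (h + v) - G v - L h| <= e * `|h|) ->
  is_diff v G L.
Proof.
move=> cL GL.
have vGL : G \o shift v = cst (G v) + L +o_ 0 id.
  apply/eqaddoP => e /GL; apply: filterS => h /=.
  by rewrite !fctE /= opprD addrA.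
have dG := diff_unique cL vGL.
by apply: DiffDef; [apply/diff_locallyP; rewrite dG|].
Qed.

Section local_primitive.
Context {R : realType} {k : nat}.
Local Notation V := 'rV[R]_k.

Lemma closure_ball_sub (c : V) (r r' : R) : r < r' -> closure (ball c r) `<=` ball c r'.
Proof.
move=> rr' v; rewrite -ball_normE /= => clv.
have e0 : 0 < r' - r by rewrite subr_gt0.
have [z []] := clv _ (nbhsx_ballx v _ e0).
rewrite -!ball_normE /= => cz vz.
rewrite -(subrKA z) (le_lt_trans (ler_normD _ _))// [`|z - v|]distrC.
by rewrite -(subrKC r r') addrC [ltRHS]addrC ltrD.
Qed.

(** Goursat's lemma on [c], [v], [h + v] turns the increment of [seg_int w c] into the integral from
    [v] to [h + v], where continuity keeps [w] close to [w v]. *)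
Lemma local_primitive (U : set V) (w : V -> V -> R) (c : V) (r : R) :
  continuous_form U w -> infinitesimally_exact U w ->
  closure (ball c r) `<=` U -> primitive_on (ball c r) w (seg_int w c).
Proof.
move=> cw ew BU v Bv.
have cB := @segment_closed_ball R V c r.
have r0 : 0 < r.
  by rewrite (le_lt_trans (normr_ge0 (c - v)))//; move: Bv; rewrite -ball_normE.
have BU' : ball c r `<=` U by exact: subset_trans (@subset_closure _ _) BU.
have [E [dE wvE _]] := ew v (BU' _ Bv).
rewrite wvE.
have cL : continuous ('d E v) by exact/diff_continuous/dE/BU'.
apply: is_diff_near0 => // e e0.
have /nbhs_ballP[d1 /= d10 near1] := cw v (BU' _ Bv) e e0.
have /nbhs_ballP[d2 /= d20 near2] : nbhs v (ball c r).
  by apply: open_nbhs_nbhs; split => //; exact: ball_open.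
apply/nbhs_ballP; exists (Num.min d1 d2); first by rewrite /= lt_min d10.
move=> h; rewrite -ball_normE /= sub0r normrN lt_min => /andP[hd1 hd2].
have Bh : ball c r (h + v).
  by apply: near2; rewrite -ball_normE /= opprD addrC subrK normrN.
have seg a b : ball c r a -> ball c r b ->
    {in `[0, 1], forall t : R, U (a + t *: (b - a))}.
  by move=> Ba Bb t t01; apply/BU'/cB.
have Bc : ball c r c by exact: ballxx.
have := goursat cw ew cB BU Bc Bv Bh.
rewrite /tri_int (seg_int_rev cw (exact_scalable ew) (seg _ _ Bc Bh)).
move=> /eqP; rewrite subr_eq0 => /eqP <-.
rewrite [_ + _ - seg_int w c v]addrAC subrr add0r.
have dL z : differentiable ('d E v : V -> R) z by exact: linear_differentiable.
(* The linear map ['d E v] is a primitive of the constant form [w v]. *)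
have := @seg_int_close _ _ U w ('d E v) v (h + v) (e * `|h|) cw (seg _ _ Bv Bh).
rewrite -linearB addrK; apply => [t _|t t01]; first exact: dL.
rewrite diff_lin// -wvE; apply: near1.
rewrite -ball_normE /= opprD addrA subrr sub0r normrN normrZ.
move: t01; rewrite in_itv /= => /andP[t0 t1]; rewrite ger0_norm//.
by rewrite (le_lt_trans _ hd1)// ler_piMl.
Qed.

End local_primitive.

(** * Polygonal C^1 paths *)

Lemma is_diff_near_eq {R : realType} {V W : normedModType R} (f g : V -> W)
    (L : V -> W) (v : V) :
  {near v, f =1 g} -> is_diff v f L -> is_diff v g L.
Proof.
move=> fg [df <-]; apply: is_diff_near0; first exact: diff_continuous.
have fgv := nbhs_singleton fg.
have /diff_locallyP[_ /eqaddoP hf] := df.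
move=> e /hf; have : \forall h \near 0, f (h + v) = g (h + v).
  move/nbhs_ballP : fg => [d d0 fg]; apply/nbhs_ballP; exists d => // h.
  rewrite -ball_normE /= sub0r => hd; apply: fg.
  by rewrite -ball_normE /= opprD addrC subrK.
apply: filterS2 => h <-; rewrite -fgv /= !fctE /=.
by rewrite opprD addrA.
Qed.

Section smoothstep.
Context {R : realType}.

(** The square of the positive part of [x], which is C^1 with derivative [x + |x|]. *)
Definition pos_sqr (x : R) : R := x * (x + `|x|) / 2.

Lemma is_derive_pos_sqr (x : R) : is_derive x (1 : R) pos_sqr (x + `|x|).
Proof.
have [x0|x0|->] := ltgtP x 0.
- apply: (@near_eq_is_derive _ _ _ (cst 0)).
    near=> y; rewrite /pos_sqr ltr0_norm; first by rewrite subrr mulr0 mul0r.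
    by near: y; exact: lt_nbhsl.
  by rewrite ltr0_norm// subrr; exact: is_derive_cst.
- apply: (@near_eq_is_derive _ _ R ((@id R) ^+ 2)).
    near=> y; rewrite fctE /pos_sqr gtr0_norm; first by field.
    by near: y; exact: lt_nbhsr.
  rewrite gtr0_norm//; apply: is_derive_eq.
  by rewrite /GRing.scale /= expr1; ring.
- rewrite normr0 addr0.
  have d0 : is_diff (0 : R) pos_sqr (\0 : {linear R -> R}).
    apply: is_diff_near0 => [|e e0]; first exact: cst_continuous.
    near=> h; rewrite addr0 /pos_sqr mul0r mul0r !subr0.
    have he : `|h| <= e.
      near: h; apply/nbhs_ballP; exists e => //= z.
      by rewrite -ball_normE /= sub0r normrN => /ltW.
    have := ler_normD h `|h|; rewrite normr_id !normrM [`|2^-1|]ger0_norm ?invr_ge0//.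
    move: (normr_ge0 h) (normr_ge0 (h + `|h|)) he.
    by move: `|h| `|_ + _| => a b *; nra.
  apply: DeriveDef; first by apply: diff_derivable; exact: ex_diff.
  by rewrite deriveE ?diff_val//; exact: ex_diff.
Unshelve. all: by end_near. Qed.

(* Running along each side with this profile, whose derivative vanishes at 0
   and 1, makes a polygon a C^1 path. *)
Definition smoothstep (x : R) : R :=
  2 * pos_sqr x - 4 * pos_sqr (x - 2^-1) + 2 * pos_sqr (x - 1).

(** The tent equal to [4 * x] from 0 to 1/2, to [4 * (1 - x)] from there to 1, and to 0 outside
    [0, 1]. *)
Definition smoothstep' (x : R) : R :=
  2 * (x + `|x|) - 4 * (x - 2^-1 + `|x - 2^-1|) + 2 * (x - 1 + `|x - 1|).

Lemma is_derive_smoothstep (x : R) : is_derive x (1 : R) smoothstep (smoothstep' x).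
Proof.
pose f (c : R) := fun y : R => pos_sqr (y - c).
have df (c : R) : is_derive x (1 : R) (f c) (x - c + `|x - c|).
  exact/is_derive_subr/is_derive_pos_sqr.
have -> : smoothstep = 2 *: f 0 - 4 *: f 2^-1 + 2 *: f 1.
  by apply/funext => y; rewrite !fctE /f subr0.
move: (f 0) (f 2^-1) (f 1) (df 0) (df 2^-1) (df 1) => f0 f1 f2 d0 d1 d2.
have := is_deriveD (is_deriveB (is_deriveZ 2 d0) (is_deriveZ 4 d1)) (is_deriveZ 2 d2).
by rewrite subr0.
Qed.

Lemma continuous_smoothstep' : continuous smoothstep'.
Proof.
move=> x; rewrite /smoothstep'.
have cabs (c : R) : {for x, continuous (fun y : R => y - c + `|y - c|)}.
  have cs : (fun y : R => y - c) @ x --> x - c by apply: cvgB; [exact: cvg_id|exact: cvg_cst].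
  by apply: cvgD => //; exact: cvg_norm.
have cabs0 : {for x, continuous (fun y : R => y + `|y|)}.
  by apply: cvgD; [exact: cvg_id|apply: cvg_norm; exact: cvg_id].
apply: cvgD; first apply: cvgB.
- by apply: cvgM; [exact: cvg_cst|exact: cabs0].
- by apply: cvgM; [exact: cvg_cst|exact: cabs].
- by apply: cvgM; [exact: cvg_cst|exact: cabs].
Qed.

Lemma smoothstep_le0 (x : R) : x <= 0 -> smoothstep x = 0.
Proof.
move=> x0; rewrite /smoothstep /pos_sqr !ler0_norm; [lra|lra|lra|lra].
Qed.

Lemma smoothstep_ge1 (x : R) : 1 <= x -> smoothstep x = 1.
Proof.
move=> x1; rewrite /smoothstep /pos_sqr !ger0_norm; [|lra|lra|lra].
by field.
Qed.

Lemma smoothstep_itv (x : R) : x \in `[0, 1] -> smoothstep x \in `[0, 1].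
Proof.
rewrite !in_itv /= => /andP[x0 x1]; rewrite /smoothstep /pos_sqr.
rewrite (ger0_norm x0) [`|x - 1|]ler0_norm; last by lra.
by have [h|h] := leP 0 (x - 2^-1); rewrite ?(ger0_norm h) ?(ltr0_norm h); nra.
Qed.

End smoothstep.

Section polygon.
Context {R : realType} {V : normedModType R}.
Implicit Types (p : nat -> V) (s : R).

(** A single formula in which side [i] is switched on during the time from [i] to [i + 1], so that
    differentiability at the corners needs no gluing. *)
Definition polygon p m s : V :=
  p 0%N + \sum_(i < m) smoothstep (s - i%:R) *: (p i.+1 - p i).

Definition polygon' p m s : V :=
  \sum_(i < m) smoothstep' (s - i%:R) *: (p i.+1 - p i).

Lemma polygon_end p m s : m%:R <= s -> polygon p m s = p m.
Proof.
elim: m => [|m IH] ms; first by rewrite /polygon big_ord0 addr0.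
rewrite /polygon big_ord_recr /= addrA -/(polygon p m s) IH; last first.
  by rewrite (le_trans _ ms)// ler_nat.
rewrite smoothstep_ge1; last by rewrite lerBrDr -natr1 in ms *; rewrite addrC.
by rewrite scale1r subrKC.
Qed.

Lemma polygonE p m i s : (i < m)%N -> i%:R <= s <= i.+1%:R ->
  polygon p m s = p i + smoothstep (s - i%:R) *: (p i.+1 - p i).
Proof.
move=> + /andP[i_s s_i]; elim: m => [//|m IH]; rewrite ltnS leq_eqVlt.
rewrite /polygon big_ord_recr /= addrA -/(polygon p m s) => /predU1P[im|im].
  by rewrite -im polygon_end.
rewrite IH// [X in _ + X *: _]smoothstep_le0 ?scale0r ?addr0//.
by rewrite subr_le0 (le_trans s_i)// ler_nat.
Qed.

Lemma polygon_start p m : polygon p m 0 = p 0%N.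
Proof.
rewrite /polygon big1 ?addr0// => i _.
by rewrite smoothstep_le0 ?scale0r// sub0r oppr_le0.
Qed.

Lemma is_derive_polygon p m s : is_derive s (1 : R) (polygon p m) (polygon' p m s).
Proof.
have dterm i : is_derive s (1 : R)
    (fun s : R => smoothstep (s - i%:R) *: (p i.+1 - p i))
    (smoothstep' (s - i%:R) *: (p i.+1 - p i)).
  exact/is_derive_scalel/is_derive_subr/is_derive_smoothstep.
have dsum := is_derive_sum (fun i : 'I_m => dterm i).
have := is_deriveD (is_derive_cst (p 0%N) s 1) dsum.
rewrite add0r; congr (is_derive _ _ _ _).
by apply/funext => y; rewrite !fctE /polygon fct_sumE.
Qed.

Lemma continuous_polygon' p m : continuous (polygon' p m).
Proof.
apply: continuous_big; first exact: add_continuous.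
move=> i _ s; apply: cvgZr_tmp.
apply: (@continuous_comp _ _ _ (fun s : R => s - i%:R) (@smoothstep' R)).
  by apply: cvgB; [exact: cvg_id|exact: cvg_cst].
exact: continuous_smoothstep'.
Qed.

End polygon.

(** * Lebesgue numbers and sums over grids *)

Lemma lebesgue_number {R : realType} {T : pseudoMetricType R} {V : topologicalType}
    (K : set T) (h : T -> V) (Q : set (set V)) : compact K ->
  {within K, continuous h} ->
  (forall z, K z -> exists2 B, Q B & nbhs (h z) B) ->
  exists2 d : R, 0 < d & forall z, K z ->
    exists2 B, Q B & forall z', K z' -> ball z d z' -> B (h z').
Proof.
move=> /compact_near_coveringP cK /subspace_continuousP ch Qh.
suff : \forall d \near (0 : R)^'+, K `<=` (fun z => exists2 B, Q B &
    forall z', K z' -> ball z d z' -> B (h z')).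
  move=> near_d; near (0 : R)^'+ => d; exists d => // z Kz.
  exact: (near near_d d).
(* Near-covering form of compactness: around each [z], one [B] serves all nearby points and all
   small [d], each taking half of a radius. *)
apply: cK => z Kz; have [B QB Bz] := Qh z Kz.
have /nbhs_ballP[e /= e0 eB] := ch z Kz _ Bz.
exists (ball z (e / 2), [set d | d < e / 2]).
  split; first by apply: nbhsx_ballx; rewrite divr_gt0.
  by apply: nbhs_right_lt; rewrite divr_gt0.
move=> [z1 d] [/= zz1 de]; exists B => // z' Kz' z1z'.
apply: eB => //; rewrite [e]splitr; apply: ball_triangle zz1 _.
exact: le_ball (ltW de) _ z1z'.
Unshelve. all: by end_near. Qed.

(** In each cell the two ways round agree, so the difference between consecutive row sums telescopes
    to the vertical terms at both ends; these are both [s x x] and cancel. The last row is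
    constant. *)
Lemma grid_sum0 {R : zmodType} {T : Type} (s : T -> T -> R) (q : nat -> nat -> T)
    (x : T) (M N : nat) :
  (forall i j, (i < M)%N -> (j < N)%N ->
     s (q i j) (q i j.+1) + s (q i j.+1) (q i.+1 j.+1) =
     s (q i j) (q i.+1 j) + s (q i.+1 j) (q i.+1 j.+1)) ->
  (forall i, (i <= M)%N -> q i 0%N = x /\ q i N = x) ->
  (forall j, (j <= N)%N -> q M j = x) -> s x x = 0 ->
  \sum_(j < N) s (q 0%N j) (q 0%N j.+1) = 0.
Proof.
move=> sq qx qM sxx; pose S i := \sum_(j < N) s (q i j) (q i j.+1).
have SM : S M = 0.
  rewrite /S big1// => j _; rewrite !qM//; exact: ltnW.
suff SS i : (i <= M)%N -> S (M - i)%N = 0 by have := SS M (leqnn M); rewrite subnn.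
elim: i => [|i IH] iM; first by rewrite subn0.
rewrite -(IH (ltnW iM)); set l := (M - i.+1)%N.
have lS : (M - i)%N = l.+1 by rewrite /l subnS prednK// subn_gt0.
have lM : (l < M)%N by rewrite -lS leq_subr.
rewrite lS /S; apply/eqP; rewrite -subr_eq0 -sumrB.
pose v j := s (q l j) (q l.+1 j).
rewrite (eq_bigr (fun j : 'I_N => - (v j.+1 - v j))).
  rewrite sumrN -(big_mkord xpredT (fun j => v j.+1 - v j)).
  rewrite telescope_sumr// /v.
  have [-> ->] := qx _ (ltnW lM); have [-> ->] := qx _ lM.
  by rewrite subrr oppr0.
move=> j _; have := sq _ _ lM (ltn_ord j).
move=> sqj; apply/eqP; rewrite opprB subr_eq addrAC eq_sym subr_eq.
by rewrite sqj.
Qed.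

(** * Global primitives on simply connected sets *)

Section chains.
Context {R : realType} {k : nat}.
Local Notation V := 'rV[R]_k.
Variables (U : set V) (w : V -> V -> R).
Hypothesis cw : continuous_form U w.

(** Closure under segments is what makes [seg_int] between two points of the set an increment of the
    primitive. *)
Definition exact_set (B : set V) :=
  [/\ segment_closed B, B `<=` U & exists G, primitive_on B w G].

Definition linked (a b : V) := exists2 B, exact_set B & B a /\ B b.

Lemma seg_int_primitive B G a b : segment_closed B -> B `<=` U ->
  primitive_on B w G -> B a -> B b -> seg_int w a b = G b - G a.
Proof.
move=> cB BU wG Ba Bb; apply/eqP; rewrite -subr_eq0 -normr_le0.
apply: (seg_int_close cw) => t t01; have Bt := cB _ _ _ Ba Bb t01.
- exact: BU.
- by have [] := wG _ Bt.
- by have [_ ->] := wG _ Bt; rewrite subrr normr0.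
Qed.

Lemma exact_set_seg_intD B a b c : exact_set B -> B a -> B b -> B c ->
  seg_int w a b + seg_int w b c = seg_int w a c.
Proof.
move=> [cB BU [G wG]] Ba Bb Bc; rewrite !(seg_int_primitive cB BU wG)//.
by rewrite addrC subrKA.
Qed.

Lemma seg_int_refl a : linked a a -> seg_int w a a = 0.
Proof.
by move=> [B [cB BU [G wG]] [Ba _]]; rewrite (seg_int_primitive cB BU wG)// subrr.
Qed.

Lemma nat_itv (m : nat) (s : R) : (0 < m)%N -> s \in `[0, m%:R] ->
  exists2 i, (i < m)%N & i%:R <= s <= i.+1%:R.
Proof.
rewrite in_itv /= => m0 /andP[s0]; elim: m m0 => // m IH _ sm.
have [ms|sm'] := leP m%:R s; first by exists m; rewrite ?ms.
case: m IH sm sm' => [|m] IH sm sm'; first by rewrite ltNge s0 in sm'.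
have [//|i im si] := IH _ (ltW sm').
by exists i => //; exact: ltnW.
Qed.

Lemma polygon_nat (p : nat -> V) m i : (i <= m)%N -> polygon p m i%:R = p i.
Proof.
rewrite leq_eqVlt => /predU1P[->|im]; first exact: polygon_end.
have ii : i%:R <= (i%:R : R) <= i.+1%:R by rewrite lexx ler_nat leqnSn.
by rewrite (polygonE p im ii) subrr smoothstep_le0// scale0r addr0.
Qed.

Lemma polygon_segment_closed B (p : nat -> V) m i (s : R) : segment_closed B ->
  B (p i) -> B (p i.+1) -> (i < m)%N -> i%:R <= s <= i.+1%:R ->
  B (polygon p m s).
Proof.
move=> cB Bi BSi im si; rewrite (polygonE p im si); apply: cB => //.
apply: smoothstep_itv; move: si; rewrite in_itv /= -natr1 => /andP[? ?].
by apply/andP; split; lra.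
Qed.

Lemma polygon_sub (p : nat -> V) m (s : R) : (0 < m)%N ->
  (forall i, (i < m)%N -> linked (p i) (p i.+1)) ->
  s \in `[0, m%:R] -> U (polygon p m s).
Proof.
move=> m0 lp /(nat_itv m0)[i im si]; have [B [cB BU _] [Bi BSi]] := lp i im.
exact/BU/(polygon_segment_closed cB Bi BSi im si).
Qed.

(** On each side the sum telescopes under a primitive on the set linking its ends. Refining a
    polygon thus keeps its integral, which allows an arbitrarily fine mesh on the homotopy. *)
Lemma sum_polygon_subdiv (p : nat -> V) m M : (0 < M)%N ->
  (forall i, (i < m)%N -> linked (p i) (p i.+1)) ->
  \sum_(j < m * M) seg_int w (polygon p m (j%:R / M%:R))
    (polygon p m (j.+1%:R / M%:R)) =
  \sum_(i < m) seg_int w (p i) (p i.+1).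
Proof.
move=> M0 lp.
have MR : 0 < M%:R :> R by rewrite ltr0n.
pose P j := polygon p m (j%:R / M%:R).
rewrite -(big_mkord xpredT (fun j => seg_int w (P j) (P j.+1))) big_nat_mul.
rewrite big_mkord; apply: eq_bigr => i _.
have [B [cB BU [G wG]] [Bi BSi]] := lp i (ltn_ord i).
have BP j : (i * M <= j <= i.+1 * M)%N -> B (P j).
  move=> /andP[ij ji]; apply: polygon_segment_closed cB Bi BSi (ltn_ord i) _.
  by rewrite ler_pdivlMr// ler_pdivrMr// -!natrM !ler_nat ij.
rewrite (eq_big_nat _ _ (F2 := fun j => G (P j.+1) - G (P j))); last first.
  move=> j /andP[ij ji]; rewrite (seg_int_primitive cB BU wG)//; apply: BP.
    by rewrite ij ltnW.
  by rewrite ji ltnW.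
rewrite (telescope_sumr (G \o P)) ?leq_mul2r ?leqnSn ?orbT//=.
rewrite (seg_int_primitive cB BU wG)// /P !natrM !mulfK ?gt_eqF//.
by rewrite !polygon_nat// ltnW.
Qed.

Hypothesis scU : simply_connected U.
Hypothesis lexact : forall u, U u -> exists2 B, exact_set B & nbhs u B.

(** The chain spans a closed polygonal path; a null homotopy of it, cut into cells each sent into
    one exact set, meets the hypotheses of [grid_sum0]. *)
Lemma closed_chain_sum0 (p : nat -> V) m :
  (forall i, (i < m)%N -> linked (p i) (p i.+1)) -> p m = p 0%N ->
  \sum_(i < m) seg_int w (p i) (p i.+1) = 0.
Proof.
move=> lp p0; have [->|] := posnP m; first by rewrite big_ord0.
move=> m0; pose g (t : R) := polygon p m (m%:R * t).
have m0R : 0 < m%:R :> R by rewrite ltr0n.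
have gpath : continuous_path_in U (p 0%N) (p 0%N) g.
  split; rewrite /g ?mulr0 ?mulr1 ?polygon_start ?polygon_nat//.
    apply: continuous_subspaceT => t.
    apply: (@continuous_comp R R V ( *%R m%:R) (polygon p m)).
      exact: mulrl_continuous.
    apply/differentiable_continuous/derivable1_diffP.
    by have ? := is_derive_polygon p m (m%:R * t); exact: ex_derive.
  move=> s; rewrite in_itv /= => /andP[s0 s1]; apply: polygon_sub => //.
  by rewrite in_itv /= mulr_ge0 ?(ltW m0R)//= ler_piMr// ltW.
have [H [cH UH Hg Hx Hends]] := scU.2 _ _ gpath.
have cK : compact (`[0, 1] `*` `[0, 1] : set (R * R)).
  by apply: compact_setX; exact: segment_compact.
have [|d d0 hd] := lebesgue_number cK cH (Q := exact_set).
  by move=> [s t] [/= s01 t01]; exact/lexact/UH.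
have [n nd] : exists n, n.+1%:R^-1 < d.
  have := near_infty_natSinv_lt (PosNum d0) => /= -[n _ hn].
  by exists n; exact: (hn n (leqnn n)).
(* A multiple of [m], so that row 0 of the grid subdivides each side of the polygon into [n.+1]
   parts; at least [n.+1], so that the mesh is below [d]. *)
pose N := (m * n.+1)%N.
have N0 : (0 < N)%N by rewrite muln_gt0 m0.
have N0R : 0 < N%:R :> R by rewrite ltr0n.
have Nd : N%:R^-1 < d.
  apply: le_lt_trans nd; rewrite lef_pV2 ?posrE ?ltr0n//.
  by rewrite ler_nat leq_pmull.
pose z i j : R * R := (i%:R / N%:R, j%:R / N%:R).
have z01 i : (i <= N)%N -> (i%:R / N%:R : R) \in `[0, 1].
  move=> iN; rewrite in_itv /= divr_ge0//= ler_pdivrMr// mul1r ler_nat//.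
have zK i j : (i <= N)%N -> (j <= N)%N -> (`[0, 1] `*` `[0, 1] : set (R * R)) (z i j).
  by move=> iN jN; split; exact: z01.
have stepS i : `|i%:R / N%:R - i.+1%:R / N%:R| < d.
  by rewrite -mulrBl -natr1 opprD addrA subrr sub0r mulN1r normrN gtr0_norm// invr_gt0.
have step0 i : `|i%:R / N%:R - i%:R / N%:R : R| < d by rewrite subrr normr0.
pose q i j := H (z i j).
have cell i j : (i < N)%N -> (j < N)%N -> exists2 B, exact_set B &
    [/\ B (q i j), B (q i j.+1), B (q i.+1 j) & B (q i.+1 j.+1)].
  move=> iN jN; have [B eB hB] := hd _ (zK _ _ (ltnW iN) (ltnW jN)).
  by exists B => //; split; (apply: hB; [apply: zK => //; exact: ltnW|]);
    split; rewrite /= -ball_normE /=.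
have U0 : U (p 0%N).
  by rewrite -(polygon_start p m); apply: polygon_sub => //; rewrite in_itv /= lexx ltW.
have q0 : \sum_(j < N) seg_int w (q 0%N j) (q 0%N j.+1) = 0.
  apply: (@grid_sum0 _ _ (seg_int w) q (p 0%N) N N).
  - move=> i j iN jN; have [B eB [? ? ? ?]] := cell i j iN jN.
    by rewrite !(exact_set_seg_intD eB).
  - by move=> i /z01 /Hends; rewrite /q /z mul0r divff ?gt_eqF.
  - by move=> j jN; rewrite /q /z divff ?gt_eqF// Hx// z01.
  - have [B eB /nbhs_singleton Bu] := lexact U0.
    by apply: seg_int_refl; exists B.
rewrite -(sum_polygon_subdiv (ltn0Sn n) lp) -[RHS]q0; apply: eq_bigr => j _.
have qE i : (i <= N)%N -> q 0%N i = polygon p m (i%:R / n.+1%:R).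
  move=> iN; rewrite /q /z mul0r Hg ?z01// /g; congr polygon.
  by rewrite /N natrM invfM mulrCA !mulrA mulfK ?gt_eqF.
by rewrite !qE// ltnW.
Qed.

(** The real index accumulates the integrals of the steps, so that concatenating chains adds their
    values. *)
Inductive chain : V -> V -> R -> Prop :=
| ChainNil u : chain u u 0
| ChainCons u v x r : linked u v -> chain v x r ->
    chain u x (seg_int w u v + r).

Lemma chain_cat u v x r r' : chain u v r -> chain v x r' -> chain u x (r + r').
Proof.
elim=> [y|y y' y'' s l c IH] c'; first by rewrite add0r.
by rewrite -addrA; apply: ChainCons l _; exact: IH.
Qed.

Lemma chain_nat u v r : chain u v r -> exists m (p : nat -> V),
  [/\ p 0%N = u, p m = v, forall i, (i < m)%N -> linked (p i) (p i.+1) &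
    r = \sum_(i < m) seg_int w (p i) (p i.+1)].
Proof.
elim=> [y|y y' y'' s l _ [m [p [p0 pm lp ->]]]].
  by exists 0%N, (fun=> y); rewrite big_ord0.
exists m.+1, (fun i => if i is j.+1 then p j else y).
split => //; last by rewrite big_ord_recl /= p0.
by case=> [|i] im; [rewrite p0|exact: lp].
Qed.

Lemma nat_chain (p : nat -> V) m :
  (forall i, (i < m)%N -> linked (p i) (p i.+1)) -> exists r, chain (p 0%N) (p m) r.
Proof.
elim: m => [|m IH] lp; first by exists 0; exact: ChainNil.
have [|r c] := IH; first by move=> i im; apply: lp; exact: ltnW.
exists (r + (seg_int w (p m) (p m.+1) + 0)); apply: chain_cat c _.
by apply: ChainCons (ChainNil _); exact: lp.
Qed.

Lemma closed_chain0 u r : chain u u r -> r = 0.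
Proof.
by move=> /chain_nat[m [p [p0 pm lp ->]]]; apply: closed_chain_sum0; rewrite ?pm.
Qed.

(** A path sampled at a mesh below a Lebesgue number has its consecutive points in common exact
    sets. *)
Lemma chain_exists u v : U u -> U v -> exists r, chain u v r.
Proof.
move=> Uu Uv; have [g [cg <- <- Ug]] := scU.1 u v Uu Uv.
have [|d d0 hd] := lebesgue_number (@segment_compact R 0 1) cg (Q := exact_set).
  by move=> t t01; exact/lexact/Ug.
have [n nd] : exists n, n.+1%:R^-1 < d.
  have := near_infty_natSinv_lt (PosNum d0) => /= -[n _ hn].
  by exists n; exact: (hn n (leqnn n)).
have n0R : 0 < n.+1%:R :> R by rewrite ltr0n.
have t01 i : (i <= n.+1)%N -> (i%:R / n.+1%:R : R) \in `[0, 1].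
  by move=> iN; rewrite in_itv /= divr_ge0//= ler_pdivrMr// mul1r ler_nat.
have := @nat_chain (fun i => g (i%:R / n.+1%:R)) n.+1.
rewrite mul0r divff ?gt_eqF//; apply => i im.
have [B eB hB] := hd _ (t01 _ (ltnW im)).
exists B => //; split; apply: hB.
- exact/t01/ltnW.
- exact: ballxx.
- exact: t01.
- rewrite -ball_normE /= -mulrBl -natr1 opprD addrA subrr sub0r mulN1r normrN.
  by rewrite gtr0_norm// invr_gt0.
Qed.

(** [G u] is the value of a chain from [u0] to [u]. As closed chains have value 0, near each point
    [G] differs from a local primitive by a constant. *)
Theorem global_primitive u0 : U u0 -> exists G, primitive_on U w G.
Proof.
move=> U0.
have /choice[G GP] : forall u, exists r, U u -> chain u0 u r.
  move=> u; have [Uu|nUu] := pselect (U u); last by exists 0.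
  by have [r c] := chain_exists U0 Uu; exists r.
exists G => u Uu; have [B eB Bu] := lexact Uu.
have [cB BU [G0 wG]] := eB.
have Buu := nbhs_singleton Bu.
(* The same chain back to [u0] closes both the chain to [u] and the chain to [v] extended by the
   link from [v] to [u]; comparing the two closed chains gives [GE]. *)
have [r rc] := chain_exists Uu U0.
have GE v : B v -> G v = G0 v - G0 u + G u.
  move=> Bv; have h1 := closed_chain0 (chain_cat (GP u Uu) rc).
  have luv : linked v u by exists B.
  have := closed_chain0 (chain_cat (GP v (BU _ Bv)) (ChainCons luv rc)).
  rewrite (seg_int_primitive cB BU wG)//; lra.
have dG0 := wG _ Buu.
apply: (@is_diff_near_eq _ _ _ (G0 + cst (G u - G0 u))).
  by apply: filterS Bu => v Bv; rewrite (GE v Bv) !fctE addrCA addrC.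
have := is_diffD dG0 (is_diff_cst (G u - G0 u) u).
by rewrite addr0.
Qed.

(** Since [endpoint_integral] quantifies over all paths, at least one path is needed to determine
    its value. *)
Lemma C1_path_exists u v : U u -> U v ->
  exists t1 gamma, C1_path_in U u v t1 gamma.
Proof.
move=> Uu Uv; have [r c] := chain_exists Uu Uv.
have luu : linked u u.
  by have [B eB /nbhs_singleton Bu] := lexact Uu; exists B.
have [m [q [q0 qm lq _]]] := chain_nat c.
(* Repeating the point [u] makes the number of sides positive, hence also the length of the time
   interval, even for the empty chain. *)
pose p i := if i is j.+1 then q j else u.
have lp i : (i < m.+1)%N -> linked (p i) (p i.+1).
  by case: i => [|i] im; [rewrite /= q0|exact: lq].
exists m.+1%:R, (polygon p m.+1); split.
- by rewrite ltr0n.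
- move=> s sm; split; first exact: polygon_sub.
  by have ? := is_derive_polygon p m.+1 s; exact: ex_derive.
- apply: continuous_subspaceT.
  have -> : derive1 (polygon p m.+1) = polygon' p m.+1.
    apply/funext => s; have ? := is_derive_polygon p m.+1 s.
    by rewrite derive1E derive_val.
  exact: continuous_polygon'.
- by rewrite polygon_start.
- by rewrite polygon_end.
Qed.

End chains.

(** * Line integrals *)

Section finite_dimension.
Context {R : realType}.

Lemma norm_coord_le {n} (x : 'rV[R]_n) (i : 'I_n) : `|x 0 i| <= `|x|.
Proof.
by rewrite [leRHS]/Num.Def.normr /= mx_normrE; exact: (le_bigmax _ _ (0, i)).
Qed.

Lemma norm_row_le {n} (x : 'rV[R]_n) (c : R) : 0 <= c ->
  (forall i, `|x 0 i| <= c) -> `|x| <= c.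
Proof.
move=> c0 xc; rewrite [leLHS]/Num.Def.normr /= mx_normrE bigmax_le// => -[i j] _.
by rewrite /= ord1.
Qed.

Lemma continuous_linear_rV {n} {W : normedModType R} (L : {linear 'rV[R]_n -> W}) :
  continuous L.
Proof.
have -> : (L : _ -> _) = (fun x => \sum_(i < n) x 0 i *: L 'e_i).
  apply/funext => x; rewrite {1}[x]row_sum_delta linear_sum.
  by apply: eq_bigr => i _; rewrite linearZ.
apply: continuous_big; first exact: add_continuous.
move=> i _ x; apply: (@cvgZr_tmp _ _ _ (nbhs x) _ (fun x : 'rV[R]_n => x 0 i)).
exact: (@coord_continuous R 1 n 0 i x).
Qed.

Lemma is_diff_linear_rV {n} {W : normedModType R} (L : {linear 'rV[R]_n -> W})
  (x : 'rV[R]_n) : is_diff x L L.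
Proof.
have cL := @continuous_linear_rV _ _ L.
by apply: DiffDef; [exact: linear_differentiable|exact: diff_lin].
Qed.

Lemma continuous_bilinear_rV {m n} {W : normedModType R}
    (B : {bilinear 'rV[R]_m -> 'rV[R]_n -> W}) :
  continuous (fun p => B p.1 p.2).
Proof.
have -> : (fun p => B p.1 p.2) =
    (fun p => \sum_(i < m) p.1 0 i *: B 'e_i p.2).
  apply/funext => p; rewrite {1}[p.1]row_sum_delta linear_sumlz.
  by apply: eq_bigr => i _; rewrite linearZl_LR.
apply: continuous_big; first exact: add_continuous.
move=> i _ p; apply: cvgZ.
  apply: (@continuous_comp _ _ _ fst (fun x : 'rV[R]_m => x 0 i)).
    exact: cvg_fst.
  exact: (@coord_continuous R 1 m 0 i).
apply: (@continuous_comp _ _ _ snd (B 'e_i)); first exact: cvg_snd.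
exact: continuous_linear_rV.
Qed.

Lemma is_diff_bilinear_rV {V W : normedModType R} {m n}
    (B : {bilinear 'rV[R]_m -> 'rV[R]_n -> W}) (g dg : V -> 'rV[R]_m)
    (h dh : V -> 'rV[R]_n) (v : V) :
  is_diff v g dg -> is_diff v h dh ->
  is_diff v (fun z => B (g z) (h z)) (fun x => B (g v) (dh x) + B (dg x) (h v)).
Proof.
move=> Dg Dh; have Dgh := is_diff_pair Dg Dh.
have DB : is_diff (g v, h v) (fun q => B q.1 q.2)
    (fun q => B (g v) q.2 + B q.1 (h v)).
  apply: DiffDef; first exact/differentiable_bilin/continuous_bilinear_rV.
  by rewrite diff_bilin//; exact: continuous_bilinear_rV.
exact: (is_diff_comp Dgh DB).
Qed.

Lemma is_diff_row {V : normedModType R} {n} (F : V -> 'rV[R]_n)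
    (L : {linear V -> 'rV[R]_n}) (v : V) : continuous L ->
  (forall j, is_diff v (fun z => F z 0 j) (fun x => L x 0 j)) ->
  is_diff v F L.
Proof.
move=> cL FL; apply: is_diff_near0 => // e e0.
have : \forall h \near 0, forall j,
    `|F (h + v) 0 j - F v 0 j - L h 0 j| <= e * `|h|.
  apply: filter_forall => j; have [/diff_locallyP[_ +] dE] := FL j.
  rewrite dE => /eqaddoP /(_ e e0); apply: filterS => h.
  by rewrite !fctE /= opprD addrA.
apply: filterS => h hj; apply: norm_row_le => [|j]; first by rewrite mulr_ge0// ltW.
by rewrite !mxE.
Qed.

End finite_dimension.

Section line_integrals.
Context {R : realType} {k : nat}.
Local Notation V := 'rV[R]_k.
Variables (U : set V) (w : V -> V -> R).
Hypothesis cw : continuous_form U w.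
Hypothesis ew : infinitesimally_exact U w.

(** Joint continuity of [w]: near the limit [h x] has norm at most [|xi| + 1], so the estimate in
    the first argument is uniform, and [w u] is continuous as a differential. *)
Lemma cvg_form {T} (F : set_system T) {FF : Filter F} (g h : T -> V) u xi :
  U u -> g @ F --> u -> h @ F --> xi -> w (g x) (h x) @[x --> F] --> w u xi.
Proof.
move=> Uu gu hxi; apply/cvgrPdist_le => e e0.
have [E [dE wE _]] := ew Uu.
have wh : w u (h x) @[x --> F] --> w u xi.
  rewrite wE; apply: (@cvg_comp _ _ _ h ('d E u)) hxi _.
  exact/diff_continuous/dE.
have xi1 : 0 < `|xi| + 1 by rewrite ltr_wpDl.
have e2 : 0 < e / 2 by rewrite divr_gt0.
have e1 : 0 < e / 2 / (`|xi| + 1) by rewrite divr_gt0.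
have n1 : \forall x \near F, forall eta,
    `|w (g x) eta - w u eta| <= e / 2 / (`|xi| + 1) * `|eta|.
  exact: gu _ (cw Uu e1).
have n2 : \forall x \near F, `|w u xi - w u (h x)| <= e / 2.
  by move/cvgrPdist_le : wh; apply.
have n3 : \forall x \near F, `|xi - h x| <= 1.
  by move/cvgrPdist_le : hxi; apply.
apply: filterS3 n1 n2 n3 => x /(_ (h x)) h1 h2 h3.
have h4 : `|h x| <= `|xi| + 1.
  by rewrite -[h x](subKr xi) (le_trans (ler_normB _ _))// lerD2l.
rewrite -(subrKA (w u (h x))) (le_trans (ler_normD _ _))// [e]splitr lerD//.
rewrite distrC (le_trans h1)// mulrAC ler_pdivrMr// ler_wpM2l//.
exact: ltW.
Qed.

(** By the chain rule the integrand is the derivative of [G \o gamma]; [cvg_form] makes it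
    continuous, as the fundamental theorem of calculus requires. *)
Lemma line_integral_primitive (G : V -> R) x y (t1 : R) (gamma : R -> V) :
  primitive_on U w G -> C1_path_in U x y t1 gamma ->
  \int[lebesgue_measure]_(s in `[0, t1]) w (gamma s) (derive1 gamma s) = G y - G x.
Proof.
move=> wG [t0 Ugamma cgamma <- <-].
have dgamma s : s \in `[0, t1] -> is_diff s gamma (fun h => h *: derive1 gamma s).
  move=> /Ugamma[_ dg]; apply: DiffDef; first exact/derivable1_diffP.
  by rewrite deriv1E.
have dG s : s \in `[0, t1] ->
    is_derive s (1 : R) (G \o gamma) (w (gamma s) (derive1 gamma s)).
  move=> s01; have [d dE] := is_diff_comp (dgamma s s01) (wG _ (Ugamma s s01).1).
  apply: DeriveDef; first exact: diff_derivable d.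
  by rewrite (deriveE _ d) dE /= scale1r.
have cgammas s : s \in `[0, t1] -> {for s, continuous gamma}.
  by move=> /dgamma ?; apply: differentiable_continuous; exact: ex_diff.
rewrite /Rintegral (@continuous_FTC2 _ _ (G \o gamma))//.
- apply/subspace_continuousP => s s01; apply: cvg_form.
  + exact: (Ugamma s s01).1.
  + apply: cvg_within_filter; exact: cgammas.
  + by move/subspace_continuousP : cgamma; exact.
- have cG s : s \in `[0, t1] -> (G \o gamma) z @[z --> s] --> (G \o gamma) s.
    move=> /dG ?; apply/differentiable_continuous/derivable1_diffP.
    exact: ex_derive.
  split.
  + by move=> s s01; have ? := dG s (subset_itv_oo_cc s01); exact: ex_derive.
  + by apply: cvg_at_right_filter; apply: cG; rewrite in_itv /= lexx ltW.
  + by apply: cvg_at_left_filter; apply: cG; rewrite in_itv /= lexx ltW.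
- move=> s s01; rewrite derive1E; have ? := dG s (subset_itv_oo_cc s01).
  by rewrite derive_val.
Qed.

End line_integrals.

(** * The form f dphi *)

Lemma is_diff_coord {R : realType} {n : nat} (M : 'rV[R]_n) (j : 'I_n) :
  is_diff M (fun N : 'rV[R]_n => N 0 j) (fun N => N 0 j).
Proof.
have lin : linear (fun N : 'rV[R]_n => N 0 j) by move=> a x y; rewrite !mxE.
pose linM := GRing.isLinear.Build _ _ _ _ _ lin.
pose L : {linear _ -> _} := HB.pack (fun N : 'rV[R]_n => N 0 j) linM.
have -> : (fun N : 'rV[R]_n => N 0 j) = L by [].
exact: is_diff_linear_rV.
Qed.

(** Meant for [x = f v], [y = f u], [z = f' u], [a = 'd phi v xi], [b = 'd phi u xi] and
    [c = 'd phi u (v - u)]: the left side is the error of the exact form, and each term on the right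
    has a small factor. *)
Lemma amul_remainder {R : realType} {n : nat} (A : algebra_on R n)
    (x y z a b c : 'rV[R]_n) :
  A x a - (A y a + A z (A c b)) = A (x - y - A z c) a + A (A z c) (a - b).
Proof.
rewrite 2!linearBl linearBr -2!amulA; set t := A z (A c a).
by rewrite opprD !addrA subrK.
Qed.

(** The derivative of half a square: commutativity merges the two terms of the product rule. *)
Lemma amul_half_sym {R : realType} {n : nat} (A : algebra_on R n)
    (z a b : 'rV[R]_n) : A (2^-1 *: z) (A a b + A b a) = A z (A a b).
Proof.
rewrite linearZl_LR (amulC A b) -linearZ; congr (A z _).
by rewrite scalerDr -scalerDl -[2^-1]mul1r -splitr scale1r.
Qed.

Section phiA_form.
Context {R : realType} {k n : nat}.
Local Notation V := 'rV[R]_k.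
Variables (A : algebra_on R n) (U : set V) (openU : open U).
Variables (phi f f' : V -> 'rV[R]_n).
Hypotheses (phiC2 : class_C 2 U phi) (fP : phiA_derivative A U phi f f').

Definition phiA_form (j : 'I_n) (u xi : V) : R := (A (f u) ('d phi u xi)) 0 j.

(** Continuity of the finitely many partial derivatives, summed over the basis, gives continuity of
    ['d phi] in operator norm. *)
Lemma near_diff_phi u : U u -> forall e : R, 0 < e -> \forall v \near u, forall xi,
  `|'d phi v xi - 'd phi u xi| <= e * `|xi|.
Proof.
(* A bound [e / (k + 1)] on each of the [k] partials sums to at most [e], and the denominator is
   positive even for [k = 0]. *)
move=> Uu e e0; have k0 : 0 < k%:R + 1 :> R by rewrite ltr_wpDl.
have nD : \forall v \near u, forall i : 'I_k,
    `|'D_'e_i phi u - 'D_'e_i phi v| <= e / (k%:R + 1).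
  apply: (@filter_forall V _ 
    (fun i v => `|'D_'e_i phi u - 'D_'e_i phi v| <= e / (k%:R + 1)) (nbhs u)) => i.
  have [dD _] := phiC2.2 'e_i.
  have /cvgrPdist_le := differentiable_continuous (dD u Uu).
  by apply; exact: divr_gt0.
have nU : \forall v \near u, U v by exact: open_nbhs_nbhs.
have dphiE v xi : U v -> 'd phi v xi = \sum_(i < k) xi 0 i *: 'D_'e_i phi v.
  move=> Uv; rewrite {1}[xi]row_sum_delta linear_sum; apply: eq_bigr => i _.
  by rewrite linearZ deriveE//; exact: phiC2.1.
apply: filterS2 nU nD.
move=> v Uv vD xi.
have -> : 'd phi v xi - 'd phi u xi =
    \sum_(i < k) xi 0 i *: 'D_'e_i phi v - \sum_(i < k) xi 0 i *: 'D_'e_i phi u.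
  by congr (_ - _); exact: dphiE.
rewrite -sumrB.
rewrite (le_trans (ler_norm_sum _ _ _))//.
apply: (@le_trans _ _ (\sum_(i < k) `|xi| * (e / (k%:R + 1)))).
  apply: ler_sum => i _; rewrite -scalerBr normrZ ler_pM ?norm_coord_le//.
  by rewrite distrC.
rewrite sumr_const card_ord -[leLHS]mulr_natr -mulrA [_ * `|xi|]mulrC ler_wpM2l//.
by rewrite mulrAC ler_pdivrMr// ler_pM2l// lerDl.
Qed.

Lemma near_diff_phi_bounded u : U u -> exists2 K : R, 0 < K &
  \forall v \near u, forall xi, `|'d phi v xi| <= K * `|xi|.
Proof.
move=> Uu; have [K K0 hK] := linear_lipschitz (diff_continuous (phiC2.1 u Uu)).
exists (K + 1); first by rewrite addr_gt0.
apply: filterS (near_diff_phi Uu ltr01) => v hv xi.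
rewrite -['d phi v xi](subrK ('d phi u xi)) (le_trans (ler_normD _ _))//.
by rewrite addrC mulrDl lerD.
Qed.

Lemma algebra_schwarz : exists2 C : R, 0 < C & forall x y, `|A x y| <= C * `|x| * `|y|.
Proof. exact/bilinear_schwarz/continuous_bilinear_rV. Qed.

Lemma phiA_form_continuous j : continuous_form U (phiA_form j).
Proof.
move=> u Uu e e0; have [C C0 hC] := algebra_schwarz.
have [K K0 hK] := near_diff_phi_bounded Uu.
(* [M] collects the constants of the two terms of the product estimate; [C * K] makes it positive
   even if [f u = 0]. *)
pose M := C * K + C * `|f u|.
have M0 : 0 < M by rewrite ltr_pwDl ?mulr_gt0// mulr_ge0// ltW.
pose d := e / M; have d0 : 0 < d by rewrite divr_gt0.
have [_ df _] := fP Uu.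
have nf : \forall v \near u, `|f u - f v| <= d.
  by have /cvgrPdist_le := differentiable_continuous df; apply.
apply: filterS3 hK nf (near_diff_phi Uu d0) => v h1 h2 h3 xi.
have -> : phiA_form j v xi - phiA_form j u xi =
    (A (f v - f u) ('d phi v xi) + A (f u) ('d phi v xi - 'd phi u xi)) 0 j.
  by rewrite /phiA_form linearBl linearBr subrKA !mxE.
rewrite (le_trans (norm_coord_le _ _))// (le_trans (ler_normD _ _))//.
have -> : e * `|xi| = C * d * (K * `|xi|) + C * `|f u| * (d * `|xi|).
  by rewrite -[e](@divfK _ M) ?gt_eqF// -/d /M; ring.
have C0' := ltW C0.
apply: lerD; apply: le_trans (hC _ _) _; apply: ler_pM; rewrite ?mulr_ge0//.
by rewrite ler_wpM2l// distrC.
Qed.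

(** [amul_remainder] splits the error into the first-order remainder of [f], which is o(|v - u|),
    times a bounded factor, and a factor O(|v - u|) times the variation of ['d phi]. *)
Lemma phiA_form_exact j : infinitesimally_exact U (phiA_form j).
Proof.
move=> u Uu; have [_ df dfE] := fP Uu.
pose l (v : V) := 'd phi u (v - u).
pose E (v : V) : R := (A (f u) (phi v) + A (2^-1 *: f' u) (A (l v) (l v))) 0 j.
have dl v : is_diff v l ('d phi u).
  have dsub : is_diff v (fun v => v - u) id.
    have := is_diffB (is_diff_id v) (is_diff_cst u v).
    by rewrite subr0.
  exact: (is_diff_comp dsub (is_diff_linear_rV ('d phi u) (v - u))).
have dE v : U v -> is_diff v E
    (fun xi => (A (f u) ('d phi v xi) + A (f' u) (A (l v) ('d phi u xi))) 0 j).
  move=> Uv.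
  have d1 := is_diff_comp (differentiableP (phiC2.1 v Uv))
    (is_diff_linear_rV (A (f u)) (phi v)).
  have d2 := is_diff_bilinear_rV A (dl v) (dl v).
  have d3 := is_diff_comp d2 (is_diff_linear_rV (A (2^-1 *: f' u)) (A (l v) (l v))).
  have d4 := is_diffD d1 d3.
  have d5 := is_diff_comp d4 (is_diff_coord _ j).
  apply: (is_diff_eq d5); apply/funext => xi /=; rewrite !fctE /=.
  by rewrite amul_half_sym.
exists E; split; first by move=> v /dE[].
  have [_ ->] := dE u Uu; apply/funext => xi.
  by rewrite /phiA_form /l subrr linear0 linear0l linear0r addr0.
move=> e e0; have [C C0 hC] := algebra_schwarz.
have [K K0 hK] := near_diff_phi_bounded Uu.
have hKu := nbhs_singleton hK.
pose M := C * K + C * (C * `|f' u| * K).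
have M0 : 0 < M by rewrite ltr_pwDl ?mulr_gt0// !mulr_ge0// ltW.
pose d := e / M; have d0 : 0 < d by rewrite divr_gt0.
have nf : \forall v \near u, `|f v - f u - A (f' u) (l v)| <= d * `|v - u|.
  have /diff_locallyP[_ /eqaddoP /(_ d d0) /nbhs_ballP[r /= r0 hr]] := df.
  apply/nbhs_ballP; exists r => // v uv.
  have /hr : ball (0 : V) r (v - u).
    by move: uv; rewrite -!ball_normE /= sub0r opprB.
  by rewrite !fctE /= subrK dfE opprD addrA.
have nU : \forall v \near u, U v by exact: open_nbhs_nbhs.
apply: filterS2 nU (filterI hK (filterI nf (near_diff_phi Uu d0))).
move=> v Uv [h1 [h2 h3]] xi.
have [_ ->] := dE v Uv.
have -> : phiA_form j v xi -
    (A (f u) ('d phi v xi) + A (f' u) (A (l v) ('d phi u xi))) 0 j =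
    (A (f v - f u - A (f' u) (l v)) ('d phi v xi) +
     A (A (f' u) (l v)) ('d phi v xi - 'd phi u xi)) 0 j.
  have subE (M1 M2 : 'rV[R]_n) : M1 0 j - M2 0 j = (M1 - M2) 0 j by rewrite !mxE.
  by rewrite -amul_remainder; exact: subE.
rewrite (le_trans (norm_coord_le _ _))// (le_trans (ler_normD _ _))//.
have -> : e * `|v - u| * `|xi| = C * (d * `|v - u|) * (K * `|xi|) +
    C * (C * `|f' u| * (K * `|v - u|)) * (d * `|xi|).
  by rewrite -[e](@divfK _ M) ?gt_eqF// -/d /M; ring.
have C0' := ltW C0.
apply: lerD; apply: le_trans (hC _ _) _; apply: ler_pM.
- exact: mulr_ge0.
- exact: normr_ge0.
- exact: (ler_wpM2l C0' h2).
- exact: h1.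
- exact: mulr_ge0.
- exact: normr_ge0.
- apply: (ler_wpM2l C0'); apply: le_trans (hC _ _) _.
  by apply: ler_wpM2l; [exact: mulr_ge0|exact: hKu].
- exact: h3.
Qed.

End phiA_form.

(** * Local exactness and conclusion *)

Lemma locally_exact_set {R : realType} {k : nat} (U : set 'rV[R]_k)
    (w : 'rV[R]_k -> 'rV[R]_k -> R) : open U ->
  continuous_form U w -> infinitesimally_exact U w ->
  forall u, U u -> exists2 B, exact_set U w B & nbhs u B.
Proof.
move=> openU cw ew u Uu.
have /nbhs_ballP[e /= e0 eU] : nbhs u U by exact: open_nbhs_nbhs.
(* Half the radius keeps the closure of the ball inside [U], as [local_primitive] demands. *)
have e2 : 0 < e / 2 by rewrite divr_gt0.
have clU : closure (ball u (e / 2)) `<=` U.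
  apply: subset_trans eU; apply: closure_ball_sub.
  by rewrite ltr_pdivrMr// ltr_pMr// ltr1n.
exists (ball u (e / 2)); last exact: nbhsx_ballx.
split; first exact: segment_closed_ball.
- exact: subset_trans (@subset_closure _ _) clU.
- by exists (seg_int w u); exact: local_primitive cw ew clU.
Qed.

Theorem corollary3p2 (R : realType) (n k : nat) (A : algebra_on R n)
    (U : set 'rV[R]_k) (openU : open U) (scU : simply_connected U)
    (phi : 'rV[R]_k -> 'rV[R]_n) (phiC2 : class_C 2 U phi)
    (f : 'rV[R]_k -> 'rV[R]_n) (fdiff : phiA_differentiable A U phi f)
    (u0 : 'rV[R]_k) (u0U : U u0)
    (F : 'rV[R]_k -> 'rV[R]_n)
    (FE : forall u, U u -> F u = endpoint_integral A U f phi u0 u) :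
  phiA_derivative A U phi F f.
Proof.
have [f' fP] := fdiff.
pose w := phiA_form A phi f.
have cw j : continuous_form U (w j) by
  exact: (@phiA_form_continuous _ _ _ _ _ openU _ _ _ phiC2 fP j).
have ew j : infinitesimally_exact U (w j) by
  exact: (@phiA_form_exact _ _ _ _ _ openU _ _ _ phiC2 fP j).
have lw j := locally_exact_set openU (cw j) (ew j).
have /choice[G GP] : forall j, exists G, primitive_on U (w j) G.
  by move=> j; exact: global_primitive (cw j) scU (lw j) _ u0U.
have FG u : U u -> F u = \row_j (G j u - G j u0).
  move=> Uu; apply/rowP => j0.
  (* Fixing a coordinate [j0] first supplies a locally exact form from which to build a path; for
     [n = 0] there is nothing to prove. *)
  have [t1 [gamma C1]] := C1_path_exists scU (lw j0) u0U Uu.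
  congr (fun_of_matrix _ 0 j0); rewrite FE// /endpoint_integral.
  set I := [set _ | _]; set r := \row_j _.
  have Ir : I r.
    move=> t1' gamma' C1'; apply/rowP => j; rewrite !mxE.
    exact: (line_integral_primitive (cw j) (ew j) (GP j) C1').
  (* [get] picks some element of [I], which is nonempty by [Ir]; evaluated along [gamma], it must
     agree with [r]. *)
  have /getPex/(_ _ _ C1) <- : exists r, I r by exists r.
  by rewrite (Ir _ _ C1).
move=> u Uu.
have dphi : differentiable phi u by exact: phiC2.1.
have [dF dFE] : is_diff u F (A (f u) \o 'd phi u).
  apply: is_diff_row; first exact: continuous_linear_rV.
  move=> j.
  have := is_diffB (GP j u Uu) (is_diff_cst (G j u0) u); rewrite subr0.
  apply: is_diff_near_eq.
  (* [F] is known only on [U], which is a neighbourhood of [u]. *)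
  have : \forall v \near u, U v by exact: open_nbhs_nbhs.
  by apply: filterS => v Uv; rewrite FG// mxE !fctE.
split; [exact: dphi|exact: dF|move=> xi].
exact: (congr1 (fun L => L xi) dFE).
Qed.
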